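(* Let $d\ge 1$, $n\ge 1$ and $t\ge 1$ be integers. If the directed de Bruijn graph $\vec{\mathcal B}(d,n)$ has a $t$-identifying code, then every $t$-identifying code $S$ of $\vec{\mathcal B}(d,n)$ satisfies $|S|\ge d^{n-1}(d-1)$.
   Context: Let $\mathcal A_d=\{0,1,\dots,d-1\}$ and let $\mathcal A_d^n$ be the set of strings $x=x_1x_2\cdots x_n$ of length $n$ over $\mathcal A_d$. The directed de Bruijn graph $\vec{\mathcal B}(d,n)$ has vertex set $\mathcal A_d^n$ and an arc from $x_1x_2\cdots x_n$ to $y_1y_2\cdots y_n$ if and only if $x_2\cdots x_n=y_1\cdots y_{n-1}$ (in particular constant strings carry loops). $\vec d(u,v)$ denotes the length of a shortest directed walk from $u$ to $v$. The in-ball of radius $t$ is $B_t^-(v)=\{u:\vec d(u,v)\le t\}$ (it contains $v$). For $S\subseteq V$, let $\mathrm{ID}_S(v)=B_t^-(v)\cap S$. A $t$-identifying code is a set $S\subseteq V$ such that $\mathrm{ID}_S(v)\neq\emptyset$ for every vertex $v$ and $\mathrm{ID}_S(u)\ne\mathrm{ID}_S(v)$ for all distinct vertices $u,v$. *)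

(* Defs.v *)
From HB Require Import structures.
From mathcomp Require Import all_boot.
Set Implicit Arguments.
Unset Strict Implicit.
Unset Printing Implicit Defensive.

Section Digraph.

Variables (T : finType) (e : rel T).

(* A walk of length k from u is given by the k vertices that follow u. *)
Definition has_walk (u v : T) (k : nat) : bool :=
  [exists p : k.-tuple T, path e u p && (last u p == v)].

Lemma connect_walk (u v : T) : connect e u v -> exists k, has_walk u v k.
Proof.
case/connectP=> p pathp ->; exists (size p).
by apply/existsP; exists (in_tuple p); rewrite pathp eqxx.
Qed.

(* None stands for an infinite distance. *)
Definition ddist (u v : T) : option nat :=
  if @idP (connect e u v) is ReflectT c
  then Some (ex_minn (connect_walk c)) else None.

Definition in_ball (t : nat) (v : T) : {set T} :=
  [set u | if ddist u v is Some k then k <= t else false].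

Definition ID_set (t : nat) (S : {set T}) (v : T) : {set T} :=
  in_ball t v :&: S.

Definition identifying_code (t : nat) (S : {set T}) : Prop :=
  (forall v, ID_set t S v <> set0) /\
  (forall u v, u <> v -> ID_set t S u <> ID_set t S v).

Lemma ddistP (u v : T) (k : nat) :
  ddist u v = Some k <->
  has_walk u v k /\ (forall j, has_walk u v j -> k <= j).
Proof.
rewrite /ddist; case: {-}_ / idP => [c|nc].
  case: ex_minnP => m wm minm; split=> [[<-]//|[wk mink]].
  by congr Some; apply/eqP; rewrite eqn_leq minm ?mink.
split=> // -[/existsP[p /andP[pathp /eqP lastp]] _].
by case: nc; apply/connectP; exists p.
Qed.

Lemma in_ballP (t : nat) (u v : T) :
  reflect (exists2 k, k <= t & has_walk u v k) (u \in in_ball t v).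
Proof.
rewrite inE; apply: (iffP idP) => [|[k lekt wk]].
  case E: (ddist u v) => [k|//] lekt; exists k => //.
  by case/ddistP: E.
case E: (ddist u v) => [m|].
  by case/ddistP: E => _ /(_ k wk) /leq_trans; apply.
move: E; rewrite /ddist; case: {-}_ / idP => // nc _; case: nc.
by case/existsP: wk => p /andP[pathp /eqP lastp]; apply/connectP; exists p.
Qed.

End Digraph.

(* x_2 ... x_n = y_1 ... y_(n-1) *)
Definition debruijn (d n : nat) : rel (n.-tuple 'I_d) :=
  fun x y => behead x == take n.-1 y.
Arguments debruijn : clear implicits.

(* Main.v *)
Require Import Defs.
From mathcomp Require Import all_boot.

(** Two vertices with the same in-neighbours have in-balls that differ at most
    in the two vertices themselves, so a code must contain at least one of them.
    In the de Bruijn graph the in-neighbours of [x] only depend on the prefix of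
    length [n - 1] of [x]; hence the complement of a code has at most one vertex
    for each of the [d ^ (n - 1)] prefixes. *)

Section InTwins.

Variables (T : finType) (e : rel T).

(** Replacing the last vertex [x] of a nonempty walk by [y] gives a walk of the same length;
    [u != x] rules out the empty walk. *)
Lemma in_ball_twin (t : nat) (x y u : T) :
  (forall v, e v x = e v y) -> u != x ->
  u \in in_ball e t x -> u \in in_ball e t y.
Proof.
move=> twin neq_ux /in_ballP[[|k] lekt /existsP[p /andP[pathp lastp]]].
  by move: lastp; rewrite (tuple0 p) /= (negPf neq_ux).
apply/in_ballP; exists k.+1 => //; apply/existsP.
case: p pathp lastp => p /=; case/lastP: p => [|q z] // szq.
rewrite rcons_path last_rcons => /andP[pathq eqz] /eqP eq_zx.
have szy : size (rcons q y) == k.+1 by move: szq; rewrite !size_rcons.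
exists (Tuple szy); rewrite /= rcons_path last_rcons eqxx andbT pathq /=.
by rewrite -twin -eq_zx.
Qed.

Lemma identifying_code_twin {t : nat} {S : {set T}} {x y : T} :
  identifying_code e t S -> (forall v, e v x = e v y) ->
  x \notin S -> y \notin S -> x = y.
Proof.
case=> _ sep twin xS yS; apply/eqP/negPn/negP => /eqP /sep; apply.
apply/setP=> u; rewrite ![u \in ID_set _ _ _ _]in_setI.
case uS: (u \in S); rewrite ?andbF // !andbT.
(* A code vertex differs from both twins, so the inclusion holds in both directions. *)
have neq z : z \notin S -> u != z by apply: contraNneq => <-.
by apply/idP/idP; apply: in_ball_twin => //; apply: neq.
Qed.

End InTwins.

Lemma leq_card_debruijn_noncode (d n t : nat) (S : {set n.-tuple 'I_d}) :
  identifying_code (debruijn d n) t S -> #|~: S| <= d ^ (n - 1).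
Proof.
move=> codeS.
pose prefix_of (x : n.-tuple 'I_d) := [tuple of take (n - 1) x].
(* [minn (n - 1) n] is the length that [take] carries in its tuple type. *)
have <- : #|{: (minn (n - 1) n).-tuple 'I_d}| = d ^ (n - 1).
  by rewrite card_tuple card_ord (minn_idPl (leq_subr 1 n)).
apply: (@leq_card_in _ _ prefix_of) => x y; rewrite !inE => xS yS.
move/(congr1 val) => /= eq_xy; apply: (identifying_code_twin _ _ codeS) => // v.
by rewrite /debruijn -subn1 eq_xy.
Qed.

Theorem theorem3p8 (d n t : nat) (hd : 1 <= d) (hn : 1 <= n) (ht : 1 <= t) :
  (exists S : {set n.-tuple 'I_d}, identifying_code (debruijn d n) t S) ->
  forall S : {set n.-tuple 'I_d},
    identifying_code (debruijn d n) t S -> d ^ (n - 1) * (d - 1) <= #|S|.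
Proof.
move=> _ S /leq_card_debruijn_noncode leC.
(* The goal becomes [d ^ n <= d ^ n.-1 + #|S|]; [1 <= n] enters through [prednK]. *)
rewrite mulnBr muln1 -expnSr subn1 prednK // leq_subLR.
have <- : #|{: n.-tuple 'I_d}| = d ^ n by rewrite card_tuple card_ord.
by rewrite -(cardsC S) addnC leq_add2r -subn1.
Qed.
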